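(* Let $r \ge 1$ be an integer. If $D$ is a digraph with $\chi(D) \ge r4^r$, then $\mathrm{sm}(D) \ge r$.
   Context: All digraphs are finite and have no loops and no multiple edges (but both $uv$ and $vu$ may be edges, forming a directed cycle of length 2). A set of vertices is acyclic if the subdigraph it induces contains no directed cycle. $\chi(D)$ denotes the dichromatic number of $D$: the minimum $k$ such that $V(D)$ can be partitioned into $k$ acyclic sets. A digraph is strongly-connected if for every ordered pair $(u,v)$ of vertices there is a directed path from $u$ to $v$. $\overrightarrow{K}_r$ is the digraph on $r$ vertices in which every pair of distinct vertices is joined by an edge in each direction. A digraph $D'$ is a strong $\overrightarrow{K}_r$ minor if $V(D')$ can be partitioned into $r$ non-empty sets (branch sets), each inducing a strongly-connected subdigraph, such that for any two distinct branch sets there is at least one edge in each direction between them. A digraph contains a strong $\overrightarrow{K}_r$ minor if some subdigraph of it is one. $\mathrm{sm}(D)$ is the largest $r$ such that $D$ contains a strong $\overrightarrow{K}_r$ minor. *)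

(* Defs.v *)
From HB Require Import structures.
From mathcomp Require Import all_boot.

Set Implicit Arguments.
Unset Strict Implicit.
Unset Printing Implicit Defensive.

(* A digraph is a vertex set together with a set of ordered pairs of distinct
   vertices, both drawn from a finite ground type T.  The vertex set need not be
   all of T, so that subdigraphs of a digraph over T are again digraphs over T. *)
Definition digraph_axiom (T : finType) (G : {set T} * {set T * T}) : bool :=
  [forall p in G.2, [&& p.1 \in G.1, p.2 \in G.1 & p.1 != p.2]].

Record digraph (T : finType) := Digraph {
  digraph_data : {set T} * {set T * T};
  _ : digraph_axiom digraph_data
}.

HB.instance Definition _ (T : finType) := [isSub for @digraph_data T].
HB.instance Definition _ (T : finType) := [Finite of digraph T by <:].

Section Digraphs.
Variable T : finType.
Implicit Types (D H : digraph T) (S : {set T}) (P : {set {set T}}).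

Definition vertices D : {set T} := (val D).1.
Definition arcs D : {set T * T} := (val D).2.
Definition arc D : rel T := fun u v => (u, v) \in arcs D.

Definition subdigraph H D : bool :=
  (vertices H \subset vertices D) && (arcs H \subset arcs D).

Definition induced_data D S : {set T} * {set T * T} :=
  (vertices D :&: S, [set p in arcs D | (p.1 \in S) && (p.2 \in S)]).

Lemma induced_axiom D S : digraph_axiom (induced_data D S).
Proof.
apply/forall_inP => p; rewrite !inE => /and3P[pD p1S p2S].
by have /forall_inP/(_ p pD)/and3P[-> -> ->] := valP D; rewrite p1S p2S.
Qed.

Definition induced D S : digraph T := Digraph (induced_axiom D S).

Definition dicycle D (c : seq T) : bool :=
  [&& c != [::], uniq c & cycle (arc D) c].

(* The vertices of a directed cycle are distinct, so bounding its length by #|T|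
   loses nothing; see acyclicP. *)
Definition acyclic D S : bool :=
  [forall n : 'I_#|T|.+1, [forall c : n.-tuple T, ~~ dicycle (induced D S) c]].

Lemma acyclicP D S :
  reflect (forall c : seq T, ~~ dicycle (induced D S) c) (acyclic D S).
Proof.
apply: (iffP forallP) => [acS c | acS n]; last by apply/forallP => c.
apply/negP => cyc; have /and3P[_ Uc _] := cyc.
have sz : size c < #|T|.+1 by rewrite ltnS -(card_uniqP Uc) max_card.
by have /forallP/(_ (in_tuple c))/negP := acS (Ordinal sz).
Qed.

Definition acyclic_partition D (k : nat) : bool :=
  [exists P : {set {set T}},
    [&& partition P (vertices D), #|P| == k & [forall S in P, acyclic D S]]].

Lemma acyclic1 D x : acyclic D [set x].
Proof.
apply/acyclicP => [[|y c]] //; apply/negP => /and3P[_ _].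
have no_arc u v : arc (induced D [set x]) u v = false.
  apply/negP => uv.
  have /forall_inP/(_ _ uv)/and3P[] := valP (induced D [set x]).
  by rewrite !inE /= => /andP[_ /eqP->] /andP[_ /eqP->]; rewrite eqxx.
by case: c => [|z c] /=; rewrite no_arc.
Qed.

Lemma exists_acyclic_partition D : exists k, acyclic_partition D k.
Proof.
exists #|[set [set x] | x in vertices D]|; apply/existsP.
exists [set [set x] | x in vertices D]; rewrite eqxx /=; apply/andP; split.
  apply/and3P; split.
  - rewrite /cover big_imset /=; last by move=> x y _ _; apply: set1_inj.
    by apply/eqP/setP => x; apply/bigcupP/idP => [[y yD /set1P->]|xD] //;
      exists x; rewrite ?set11.
  - apply/trivIsetP => _ _ /imsetP[x _ ->] /imsetP[y _ ->] neq.
    by rewrite disjoints1 inE; apply: contraNneq neq => ->.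
  - by apply/imsetP => [[x _ /setP/(_ x)]]; rewrite !inE eqxx.
by apply/forall_inP => _ /imsetP[x _ ->]; apply: acyclic1.
Qed.

Definition dichromatic_number D : nat := ex_minn (exists_acyclic_partition D).

Definition strongly_connected D : bool :=
  [forall u in vertices D, [forall v in vertices D, connect (arc D) u v]].

(* The last clause ranges over ordered pairs of branch sets, hence requires arcs
   in both directions. *)
Definition strong_K_minor (r : nat) H : bool :=
  [exists P : {set {set T}},
    [&& partition P (vertices H), #|P| == r,
        [forall B in P, strongly_connected (induced H B)]
      & [forall A in P, [forall B in P, (A != B) ==>
          [exists a in A, [exists b in B, arc H a b]]]]]].

Definition contains_strong_K_minor D (r : nat) : bool :=
  [exists H : digraph T, subdigraph H D && strong_K_minor r H].

Lemma contains_strong_K0_minor D : contains_strong_K_minor D 0.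
Proof.
have ax0 : @digraph_axiom T (set0, set0) by apply/forall_inP => p; rewrite inE.
apply/existsP; exists (Digraph ax0); rewrite /subdigraph !sub0set /=.
apply/existsP; exists set0; rewrite cards0 eqxx; apply/and4P; split=> //.
- rewrite /partition /cover big_set0 eqxx inE andbT /=.
  by apply/trivIsetP => A B; rewrite inE.
- by apply/forall_inP => B; rewrite inE.
- by apply/forall_inP => B; rewrite inE.
Qed.

Lemma exists_strong_K_minor D : exists r, contains_strong_K_minor D r.
Proof. by exists 0; apply: contains_strong_K0_minor. Qed.

Lemma strong_K_minor_bound D r : contains_strong_K_minor D r -> r <= #|T|.
Proof.
case/existsP=> H /andP[_ /existsP[P /and4P[partP /eqP<- _ _]]].
apply: leq_trans (max_card (vertices H)); rewrite (card_partition partP).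
rewrite -sum1_card; apply: leq_sum => A AP; rewrite card_gt0.
by have /and3P[_ _] := partP; apply: contraNneq => <-.
Qed.

Definition sm D : nat :=
  ex_maxn (exists_strong_K_minor D) (@strong_K_minor_bound D).

End Digraphs.

(* Main.v *)
From mathcomp Require Import all_boot.
Require Import Defs.

Set Implicit Arguments.
Unset Strict Implicit.
Unset Printing Implicit Defensive.

(** Writing chi for the dichromatic number, the two facts below combine into a
    proof.

    A colouring of L with chi(L) acyclic classes is complete: if some class X had
    no arc to another class Y, a directed cycle in the union of X and Y could
    never leave X, so it would lie inside X or inside Y; hence the union would be
    acyclic and merging X and Y would save a colour
    ([optimal_colouring_complete]).  So when chi(L) >= r we get r classes with
    arcs in both directions between any two; only the strong connectivity of the
    classes is missing.

    To supply it, any S with chi(S) >= 4c contains a set A with chi(A) >= c and a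
    hub v in S \ A such that each x in A lies on a closed walk of S through v whose
    vertices other than x avoid A ([exists_hub]).  Indeed, fix a representative v of
    each strong component of S and sort the remaining vertices x of the component
    by their distances from v and to v.  A directed cycle stays in one component,
    and along each of its arcs the distance from v increases by at most 1 while
    the distance to v decreases by at most 1.  If the parities of both distances
    are constant on the cycle, the distances are monotone, hence constant.
    So if all layers of constant distances could be coloured with c - 1 colours,
    the pairs of parities together with these colours, and one colour for all
    representatives, would colour S with 4(c - 1) + 1 colours
    ([dichromatic_le_layers]).  And a shortest path between v and a vertex x of a
    layer meets that layer only at x ([bfs_layer_connected]).

    Starting from chi(D) >= r 4^r, repeat this r times, each time inside the
    layer just found ([nested_hubs]).  This gives L with chi(L) >= r and pairwise
    disjoint rings R_0, ..., R_(r-1) outside L with hubs v_i in R_i, such that each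
    vertex x of L is on a closed walk through v_i that, apart from x, stays inside
    R_i.  If X_i are r classes of an optimal colouring of L, the strong component
    of v_i in the subdigraph induced by the union of X_i and R_i contains X_i.
    These components are the branch sets. *)

(** * Connectivity in a finite relation *)

Section Relations.
Variables (T : finType) (e : rel T).

Definition mutually_connected : rel T :=
  fun x y => connect e x y && connect e y x.

Lemma mutually_connected_refl : reflexive mutually_connected.
Proof. by move=> x; rewrite /mutually_connected connect0. Qed.

Lemma mutually_connected_sym : symmetric mutually_connected.
Proof. by move=> x y; rewrite /mutually_connected andbC. Qed.

Lemma mutually_connected_trans : transitive mutually_connected.
Proof.
move=> y x z /andP[xy yx] /andP[yz zy].
by rewrite /mutually_connected (connect_trans xy yz) (connect_trans zy yx).
Qed.

(** Every vertex of a walk from x to y is reachable from x and reaches y, so a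
    property of such vertices confines the walk. *)
Lemma connect_within (Q : pred T) x y :
    connect e x y -> (forall z, connect e x z -> connect e z y -> Q z) ->
  connect [rel a b | [&& Q a, Q b & e a b]] x y.
Proof.
case/connectP=> p; elim: p x => [|z p IHp] x /= => [_ -> //|/andP[xz zp] Ey QP].
have zy : connect e z y by apply/connectP; exists p.
apply: connect_trans (IHp z zp Ey _); last first.
  by move=> w zw wy; apply: QP => //; apply: connect_trans (connect1 xz) zw.
have xy := connect_trans (connect1 xz) zy.
by apply: connect1; rewrite /= xz !QP // connect1.
Qed.

Lemma connect_closed (Q : pred T) x y :
  (forall a b, e a b -> Q a -> Q b) -> connect e x y -> Q x -> Q y.
Proof.
move=> Qe /connectP[p ep ->]; elim: p x ep => //= z p IHp x /andP[xz zp] Qx.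
exact: IHp zp (Qe _ _ xz Qx).
Qed.

End Relations.

Section Distance.
Variables (T : finType) (e : rel T).

(** Inside a strong component one can return to the start of any walk, so a
    quantity that is monotone along its arcs cannot change.  The order R is a
    parameter because the distance from a vertex is monotone in one direction and
    the distance to it in the other. *)
Lemma monotone_const_on_scc (R : rel nat) (d : T -> nat) x y :
    reflexive R -> transitive R -> antisymmetric R ->
    {in mutually_connected e x &, forall a b, e a b -> R (d a) (d b)} ->
  mutually_connected e x y -> d x = d y.
Proof.
move=> Rrefl Rtrans Ranti Rd xy.
have mono a b : mutually_connected e x a -> mutually_connected e x b ->
    connect e a b -> R (d a) (d b).
  move=> xa xb /(connect_within (Q := mutually_connected e x)) ab.
  apply: (connect_closed (Q := fun z => R (d a) (d z))) (ab _) (Rrefl _).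
    by move=> u v /= /and3P[xu xv uv] /Rtrans; apply; apply: Rd.
  move=> z az zb; have /andP[xa' _] := xa; have /andP[_ bx] := xb.
  apply/andP; split; first exact: connect_trans xa' az.
  exact: connect_trans zb bx.
have /andP[cxy cyx] := xy; apply: Ranti.
by rewrite !mono // mutually_connected_refl.
Qed.

(** [choose] depends only on the extent of its predicate, so this value is the
    same on a whole strong component. *)
Definition scc_rep x := choose (mutually_connected e x) x.

Lemma scc_rep_connected x : mutually_connected e x (scc_rep x).
Proof. exact/chooseP/mutually_connected_refl. Qed.

Lemma eq_scc_rep x y : mutually_connected e x y -> scc_rep x = scc_rep y.
Proof.
move=> xy; rewrite /scc_rep.
have /eq_choose-> : mutually_connected e x =1 mutually_connected e y.
  move=> z; apply/idP/idP; apply: mutually_connected_trans => //.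
  by rewrite mutually_connected_sym.
by apply: choose_id => //; rewrite ?mutually_connected_refl //
  mutually_connected_sym.
Qed.

(** Shortest paths have fewer than #|T| arcs; for unreachable x the value is the
    junk #|T|. *)
Definition dist v x : nat :=
  find (fun n => [exists p : n.-tuple T, path e v p && (last v p == x)])
    (iota 0 #|T|).

Lemma dist_le_path v p : path e v p -> dist v (last v p) <= size p.
Proof.
move=> vp; case: (ltnP (size p) #|T|) => [ltp|]; last first.
  by apply: leq_trans; rewrite -[#|T|](size_iota 0) find_size.
rewrite leqNgt; apply/negP => /(before_find 0).
rewrite nth_iota // add0n => /existsP[]; exists (in_tuple p).
by rewrite vp eqxx.
Qed.

Lemma shortest_path v x : connect e v x ->
  exists p, [/\ path e v p, last v p = x & size p = dist v x].
Proof.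
case/connectP=> p0 /shortenP[p vp Up _] Ex.
have ltp : size p < #|T| by rewrite -[_.+1](card_uniqP Up) max_card.
set P := (fun n => [exists q : n.-tuple T, path e v q && (last v q == x)]).
have hasP : has P (iota 0 #|T|).
  apply/hasP; exists (size p); first by rewrite mem_iota.
  by apply/existsP; exists (in_tuple p); rewrite vp Ex eqxx.
have /existsP[q /andP[vq /eqP xq]] := nth_find 0 hasP.
exists q; split=> //; rewrite size_tuple nth_iota //.
by rewrite -[X in _ < X](size_iota 0) -has_find.
Qed.

Lemma dist_succ v x y : connect e v x -> e x y -> dist v y <= (dist v x).+1.
Proof.
case/shortest_path=> p [vp Ex <-] xy.
have := @dist_le_path v (rcons p y).
by rewrite last_rcons size_rcons rcons_path vp Ex; apply.
Qed.

Lemma dist_pred v x : connect e v x -> x != v ->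
  exists y, [/\ connect e v y, e y x & dist v y < dist v x].
Proof.
case/shortest_path=> p [vp Ex <-].
case/lastP: p Ex vp => [<- _ /eqP //|p y]; rewrite last_rcons => ->.
rewrite rcons_path => /andP[vp px] _; exists (last v p).
by split=> //; [apply/connectP; exists p | rewrite size_rcons ltnS dist_le_path].
Qed.

(** The vertices of a shortest path other than its end x are closer to v than x,
    so they satisfy every property shared by the closer vertices. *)
Lemma connect_through_closer (Q : pred T) v x :
    connect e v x ->
    (forall z, connect e v z -> z = x \/ dist v z < dist v x -> Q z) ->
  connect [rel a b | [&& Q a, Q b & e a b]] v x.
Proof.
move=> vx Qx.
suff H n z : dist v z < n -> connect e v z ->
    (forall w, connect e v w -> w = z \/ dist v w < dist v z -> Q w) ->
    connect [rel a b | [&& Q a, Q b & e a b]] v z.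
  exact: H (ltnSn _) vx Qx.
elim: n z => // n IHn z; rewrite ltnS => dz vz Qz.
have [->//|/(dist_pred vz)[y [vy yz ltyz]]] := eqVneq z v.
apply: (@connect_trans _ _ y); last first.
  by apply: connect1; rewrite /= yz !Qz //; [left | right].
apply: IHn => //; first exact: leq_trans dz.
by move=> w vw Hw; apply: Qz => //; right; case: Hw => [->//|/ltn_trans]; apply.
Qed.

End Distance.

(** * Acyclic sets and colourings *)

Section Digraphs.
Variable T : finType.
Implicit Types (D : digraph T) (A B S : {set T}).

Lemma arcP D x y :
  arc D x y -> [/\ x \in vertices D, y \in vertices D & x != y].
Proof. by move=> xy; have /forall_inP/(_ _ xy)/and3P[] := valP D. Qed.

Lemma vertices_induced D S : vertices (induced D S) = vertices D :&: S.
Proof. by []. Qed.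

Lemma arc_induced D S x y :
  arc (induced D S) x y = [&& x \in S, y \in S & arc D x y].
Proof. by rewrite /arc /arcs /= inE andbC andbA. Qed.

Lemma digraph_eq D1 D2 : vertices D1 = vertices D2 -> arc D1 =2 arc D2 -> D1 = D2.
Proof.
move=> eqV eqA; apply: val_inj; apply/eqP; rewrite -pair_eqE /=.
apply/andP; split; first exact/eqP.
by apply/eqP/setP => -[x y]; apply: eqA.
Qed.

Lemma induced_induced D S A : induced (induced D S) A = induced D (S :&: A).
Proof.
apply: digraph_eq => [|x y]; first by rewrite !vertices_induced setIA.
rewrite !arc_induced !inE.
by case: (x \in S); case: (y \in S); case: (x \in A); case: (y \in A).
Qed.

Lemma induced_vertices D : induced D (vertices D) = D.
Proof.
apply: digraph_eq => [|x y]; first by rewrite vertices_induced setIid.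
rewrite arc_induced andbA; apply: andb_idl => /arcP[-> ->//].
Qed.

Lemma connect_induced_sub D A B x y : A \subset B ->
  connect (arc (induced D A)) x y -> connect (arc (induced D B)) x y.
Proof.
move=> /subsetP sAB; apply: connect_sub => u v.
rewrite arc_induced => /and3P[uA vA uv].
by apply: connect1; rewrite arc_induced !sAB.
Qed.

(** A directed cycle is an arc together with a way back: this replaces sequences
    of distinct vertices by reachability. *)
Lemma acyclic_connect D A :
  reflect (forall x y, arc (induced D A) x y ->
             ~~ connect (arc (induced D A)) y x) (acyclic D A).
Proof.
apply: (iffP (acyclicP _ _)) => [acA x y xy | acA [//|x c]].
  apply/negP => /connectP[p0 /shortenP[p yp Up _] Ex].
  have /negP[] := acA (y :: p); apply/and3P; split=> //.
  by rewrite /= rcons_path yp -Ex.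
apply/negP => /and3P[_ _ /=]; case: c => [|y c].
  by rewrite /= andbT => /acA; rewrite connect0.
rewrite rcons_path /= -andbA => /and3P[xy yc cx].
have /negP[] := acA _ _ xy; apply/connectP; exists (rcons c x).
  by rewrite rcons_path yc.
by rewrite last_rcons.
Qed.

Lemma acyclic_sub D A B : A \subset B -> acyclic D B -> acyclic D A.
Proof.
move=> sAB /acyclic_connect acB; apply/acyclic_connect => x y xy.
apply: contra (acB x y _); first exact: connect_induced_sub.
by move: xy; rewrite !arc_induced => /and3P[/(subsetP sAB)-> /(subsetP sAB)->].
Qed.

Lemma acyclic_induced D S A : acyclic (induced D S) A = acyclic D (S :&: A).
Proof. by apply/acyclic_connect/acyclic_connect; rewrite induced_induced. Qed.

(** Stated with a list of admissible colours in an arbitrary type, so that colours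
    can be tuples and the count is the size of the list. *)
Lemma dichromatic_le_colours D (K : eqType) (f : T -> K) (s : seq K) :
    {in vertices D, forall x, f x \in s} ->
    (forall k, acyclic D [set x in vertices D | f x == k]) ->
  dichromatic_number D <= size s.
Proof.
move=> fs acf; pose P := preim_partition f (vertices D).
have partP : partition P (vertices D) by apply: preim_partitionP.
have defP A : A \in P -> exists2 x, x \in vertices D &
    A = [set y in vertices D | f y == f x].
  case/imsetP=> x xD ->; exists x => //; apply/setP => y.
  by rewrite !inE [f x == _]eq_sym.
have : dichromatic_number D <= #|P|.
  rewrite /dichromatic_number; case: ex_minnP => k _; apply.
  apply/existsP; exists P; rewrite partP eqxx /=; apply/forall_inP => A.
  by case/defP=> x _ ->.
move/leq_trans; apply; rewrite cardE.
rewrite -(size_map (fun k => [set x in vertices D | f x == k]) s).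
apply: uniq_leq_size; first exact: enum_uniq.
move=> A; rewrite mem_enum => /defP[x xD ->].
by apply: (map_f (fun k => [set y in _ | f y == k])); apply: fs.
Qed.

Lemma optimal_colouring D : exists f : T -> nat,
  {in vertices D, forall x, f x < dichromatic_number D} /\
  forall k, acyclic D [set x in vertices D | f x == k].
Proof.
rewrite /dichromatic_number; case: ex_minnP => k.
case/existsP=> P /and3P[partP /eqP<- /forall_inP acP] _.
have /and3P[/eqP covP tiP P0] := partP.
exists (fun x => index (pblock P x) (enum P)); split=> [x xD | k'].
  by rewrite cardE index_mem mem_enum pblock_mem ?covP.
set C := [set x in _ | _]; have [->|[x]] := set_0Vmem C.
  apply/acyclic_connect => x y; rewrite arc_induced inE //.
rewrite inE => /andP[xD /eqP Ek].
apply: (acyclic_sub (B := pblock P x)); last by rewrite acP ?pblock_mem ?covP.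
apply/subsetP => y; rewrite inE -Ek => /andP[yD /eqP Exy].
have inP z : z \in vertices D -> pblock P z \in enum P.
  by rewrite mem_enum -covP; apply: pblock_mem.
have := congr1 (nth set0 (enum P)) Exy; rewrite !nth_index ?inP // => <-.
by rewrite mem_pblock covP.
Qed.

(** A walk in the union that enters A can never leave it, so a directed cycle is
    contained in A or in B. *)
Lemma acyclicU D A B : acyclic D A -> acyclic D B ->
  {in A & B, forall x y, ~~ arc D x y} -> acyclic D (A :|: B).
Proof.
move=> acA acB noAB; apply/acyclic_connect => x y xy.
set e := arc _ in xy *; apply/negP => yx.
have eE a b : e a b = [&& (a \in A) || (a \in B), (b \in A) || (b \in B) & arc D a b].
  by rewrite /e arc_induced !inE.
have eA a b : e a b -> a \in A -> b \in A.
  rewrite eE => /and3P[_ /orP[//|bB] ab] aA.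
  by have := noAB a b aA bB; rewrite ab.
have stays (C : {set T}) : x \in C -> y \in C ->
    (forall z, connect e y z -> connect e z x -> z \in C) -> ~~ acyclic D C.
  move=> xC yC inC; apply/acyclic_connect => /(_ x y).
  rewrite arc_induced xC yC; move: (xy); rewrite eE => /and3P[_ _ ->].
  move=> /(_ isT)/negP[]; apply: connect_sub (connect_within yx inC) => a b /=.
  case/and3P=> aC bC; rewrite eE => /and3P[_ _ ab].
  by apply: connect1; rewrite arc_induced aC bC.
have sAA := connect_closed eA.
have [xA|xA] := boolP (x \in A).
  have yA := eA _ _ xy xA; have /negP[] := stays A xA yA (fun z yz _ => sAA _ _ yz yA).
  exact: acA.
have inB z : connect e y z -> connect e z x -> z \in B.
  move=> yz zx; have zA : z \notin A by apply: contra xA => /(sAA _ _ zx).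
  have : (z \in A) || (z \in B); last by rewrite (negPf zA).
  apply: (connect_closed (Q := fun z => (z \in A) || (z \in B)) _ yz).
    by move=> a b; rewrite eE => /and3P[].
  by move: xy; rewrite eE => /and3P[].
have xB : x \in B by move: xy; rewrite eE (negPf xA) => /and3P[].
by have /negP[] := stays B xB (inB _ (connect0 _ _) yx) inB.
Qed.

(** If there were no arc from class i to class j, their union would be acyclic
    and giving colour i to class j would save the colour j. *)
Lemma optimal_colouring_complete D : exists f : T -> nat,
  forall i j, i < dichromatic_number D -> j < dichromatic_number D -> i != j ->
    exists x y, [/\ f x = i, f y = j & arc D x y].
Proof.
have [f [fD acf]] := optimal_colouring D; exists f => i j.
set c := dichromatic_number D in fD * => ic jc ij.
case: (boolP [exists x, [exists y, [&& f x == i, f y == j & arc D x y]]]).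
  by move=> /existsP[x /existsP[y /and3P[/eqP fx /eqP fy xy]]]; exists x, y.
move=> /existsPn noij; exfalso.
pose g x := if f x == j then i else f x.
have : c <= size (rem j (iota 0 c)).
  apply: (dichromatic_le_colours (f := g)) => [x xD | k].
    rewrite (mem_rem_uniq _ (iota_uniq 0 c)) inE mem_iota /= /g.
    by have [_|fj] := eqVneq (f x) j; rewrite ?ij ?fj ?add0n ?fD.
  have [->|ki] := eqVneq k i; last first.
    apply: acyclic_sub (acf k); apply/subsetP => x; rewrite !inE /g.
    by case: (f x == j) => //; rewrite [i == k]eq_sym (negPf ki) andbF.
  apply: (acyclic_sub (B := [set x in vertices D | f x == i] :|:
                             [set x in vertices D | f x == j])).
    apply/subsetP => x; rewrite !inE /g -andb_orr.
    by case: (f x == j); rewrite ?orbT ?orbF // => /andP[->].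
  apply: acyclicU => // x y; rewrite !inE => /andP[_ fx] /andP[_ fy].
  by have /existsPn/(_ y) := noij x; rewrite fx fy.
rewrite size_rem ?mem_iota // size_iota.
by case: (c) ic => // n _; rewrite ltnn.
Qed.

End Digraphs.

(** * Breadth-first layers *)

Section Layers.
Variables (T : finType) (e : rel T).

Definition dist_out x := dist e (scc_rep e x) x.
Definition dist_in x := dist [rel a b | e b a] (scc_rep e x) x.

(** The representative itself is left out: it serves as the hub of its layers. *)
Definition bfs_layer x : {set T} :=
  [set y | [&& scc_rep e y == scc_rep e x, y != scc_rep e y,
               dist_out y == dist_out x & dist_in y == dist_in x]].

(** Shortest paths from the hub to y and from y to the hub pass only through
    vertices that are strictly closer to the hub in the relevant sense, and these
    are not in the layer of y. *)
Lemma bfs_layer_connected x y : y \in bfs_layer x ->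
  mutually_connected
    [rel a b | [&& a \in y |: ~: bfs_layer x, b \in y |: ~: bfs_layer x & e a b]]
    (scc_rep e x) y.
Proof.
move=> yL; set Q := mem (y |: _).
have := yL; rewrite inE => /and4P[/eqP Er _ /eqP Eo /eqP Ei].
have /andP[yr ry] := scc_rep_connected e y; rewrite Er in yr ry.
have QP z d : d z < d y -> (z \in bfs_layer x -> d z = d y) -> Q z.
  move=> ltz Hz; rewrite /Q inE in_setU1 in_setC orbC.
  by case: (z \in _) Hz => //= /(_ isT) E; rewrite E ltnn in ltz.
have Qy : Q y by rewrite /Q inE setU11.
apply/andP; split.
  apply: (connect_through_closer ry) => z _ [->//|ltz].
  apply: (QP z (dist e (scc_rep e x))) => //; rewrite inE.
  case/and4P=> /eqP Ez _ /eqP Eoz _.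
  by move: Eo Eoz; rewrite /dist_out Er Ez => -> ->.
have := @connect_through_closer _ [rel a b | e b a] Q (scc_rep e x) y.
rewrite connect_rev => /(_ yr).
rewrite (@eq_connect _ _ [rel a b | [rel u v | [&& Q u, Q v & e u v]] b a]); last first.
  by move=> a b /=; rewrite andbCA.
rewrite connect_rev; apply => z _ [->//|ltz].
apply: (QP z (dist [rel a b | e b a] (scc_rep e x))) => //; rewrite inE.
case/and4P=> /eqP Ez _ _ /eqP Eiz.
by move: Ei Eiz; rewrite /dist_in Er Ez => -> ->.
Qed.

End Layers.

Section Hubs.
Variable T : finType.
Implicit Types (D : digraph T) (A B S : {set T}).

Lemma connect_induced_mem D S x y :
  connect (arc (induced D S)) x y -> y != x -> y \in S.
Proof.
move=> xy nyx; have [z [_ + _]] := dist_pred xy nyx.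
by rewrite arc_induced => /and3P[].
Qed.

Lemma bfs_layer_sub D S x : bfs_layer (arc (induced D S)) x \subset S.
Proof.
apply/subsetP => y; rewrite inE => /and4P[_ nry _ _].
have /andP[_ ry] := scc_rep_connected (arc (induced D S)) y.
exact: connect_induced_mem ry nry.
Qed.

Lemma leq_same_parity m n : odd m = odd n -> m <= n.+1 -> m <= n.
Proof.
move=> Eodd; rewrite leq_eqVlt => /orP[/eqP Em|//].
by move: Eodd; rewrite Em /=; case: (odd n).
Qed.

(** Colour the representatives of strong components with one extra colour, and any
    other vertex by the parities of its two distances and its colour within its
    layer.  A monochromatic cycle lies in one strong component, so it is not made
    of representatives; equal parities then keep it in one layer, where it is
    monochromatic for a colouring with acyclic classes. *)
Lemma dichromatic_le_layers D S m :
    (forall x, dichromatic_number (induced D (bfs_layer (arc (induced D S)) x)) <= m) ->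
  dichromatic_number (induced D S) <= (4 * m).+1.
Proof.
set e := arc (induced D S); move=> chiL.
have [F FP] := fin_all_exists (fun A : {set T} => optimal_colouring (induced D A)).
pose g x := if x == scc_rep e x then None else
  Some ((odd (dist_out e x), odd (dist_in e x)), F (bfs_layer e x) x).
pose s := None :: [seq Some (pq, i) | pq <- enum {: bool * bool}, i <- iota 0 m].
have -> : (4 * m).+1 = size s.
  by rewrite /= size_allpairs -cardE card_prod card_bool size_iota.
have inL x : x != scc_rep e x -> x \in bfs_layer e x by rewrite inE !eqxx => ->.
apply: (dichromatic_le_colours (f := g)) => [x | k].
  rewrite vertices_induced inE => /andP[xD xS].
  rewrite /g inE; have [//|nrx] := eqVneq x (scc_rep e x); rewrite /=.
  apply: (allpairs_f (fun pq i => Some (pq, i))); first by rewrite mem_enum.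
  rewrite mem_iota /= add0n; apply: leq_trans (chiL x).
  by apply: (FP _).1; rewrite vertices_induced inE xD inL.
set C := [set x in _ | _]; apply/acyclic_connect => x y.
set ee := arc _ => xy; apply/negP => yx.
have eeP a b : ee a b -> [/\ e a b, g a = k & g b = k].
  by rewrite /ee arc_induced !inE -/e => /and3P[/andP[_ /eqP->] /andP[_ /eqP->] ->].
have [exy gx gy] := eeP _ _ xy.
have gk z : mutually_connected ee x z -> g z = k.
  case/andP=> /(connect_closed (Q := fun z => g z == k)) H _; apply/eqP/H.
    by move=> a b /eeP[_ _ ->].
  exact/eqP.
have ce a b : connect ee a b -> connect e a b.
  by apply: connect_sub => u v /eeP[uv _ _]; apply: connect1.
have repz z : mutually_connected ee x z -> scc_rep e z = scc_rep e x.
  by case/andP=> /ce xz /ce zx; apply: eq_scc_rep; apply/andP.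
have xyc : mutually_connected ee x y by rewrite /mutually_connected connect1.
have := gk _ xyc; have := gx; have := repz _ xyc; rewrite /g.
have [Ex|nrx] := eqVneq x (scc_rep e x).
  (* Both x and y represent their common component, but arcs are not loops. *)
  move=> Ery <-; case: eqP => // Ey _.
  by have [_ _ /eqP[]] := arcP exy; rewrite Ex Ey Ery.
move=> _ Ek _.
have gz z : mutually_connected ee x z -> [/\ z != scc_rep e z,
    odd (dist_out e z) = odd (dist_out e x), odd (dist_in e z) = odd (dist_in e x)
    & F (bfs_layer e z) z = F (bfs_layer e x) x].
  move/gk; rewrite -Ek /g; case: eqP => // /eqP nrz [].
  by move=> -> -> ->.
(* Along an arc the distance from the representative grows by at most 1, hence
   not at all when parities agree; the distance to it drops by at most 1. *)
have Eout z : mutually_connected ee x z -> dist_out e x = dist_out e z.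
  apply: (monotone_const_on_scc (R := geq)); rewrite /geq /=.
  - exact: leqnn.
  - by move=> b a c /= ab bc; apply: leq_trans bc ab.
  - by move=> a b /= /andP[ab ba]; apply/eqP; rewrite eqn_leq ab ba.
  move=> a b xa xb /eeP[ab _ _] /=.
  have [_ oa _ _] := gz a xa; have [_ ob _ _] := gz b xb.
  apply: leq_same_parity; first by rewrite oa.
  rewrite /dist_out (repz a) // (repz b) //; apply: dist_succ => //.
  rewrite -(repz a) //; by have /andP[] := scc_rep_connected e a.
have Ein z : mutually_connected ee x z -> dist_in e x = dist_in e z.
  apply: (monotone_const_on_scc (R := leq)).
  - exact: leqnn.
  - exact: leq_trans.
  - exact: anti_leq.
  move=> a b xa xb /eeP[ab _ _] /=.
  have [_ _ ia _] := gz a xa; have [_ _ ib _] := gz b xb.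
  apply: leq_same_parity; first by rewrite ia.
  rewrite /dist_in (repz a) // (repz b) //; apply: dist_succ => //.
  rewrite connect_rev /= -(repz b) //; by have /andP[] := scc_rep_connected e b.
have Lz z : mutually_connected ee x z -> bfs_layer e z = bfs_layer e x.
  move=> xz; apply/setP => w; rewrite !inE (repz z) //.
  by rewrite (Eout z) // (Ein z).
pose A := bfs_layer e x; pose i := F A x.
have zA z : mutually_connected ee x z -> z \in A /\ F A z = i.
  by move=> xz; have [nrz _ _] := gz z xz; rewrite /i /A -(Lz z xz) => ->; rewrite inL.
have [_ /(_ i)] := FP A; rewrite acyclic_induced.
set B := A :&: _ => /acyclic_connect/(_ x y).
have inB z : mutually_connected ee x z -> z \in vertices D -> z \in B.
  by case/zA=> zA' Fz zD; rewrite in_setI in_set vertices_induced in_setI zA' zD Fz eqxx.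
have arcB a b : mutually_connected ee x a -> mutually_connected ee x b -> ee a b ->
    arc (induced D B) a b.
  move=> xa xb /eeP[]; rewrite /e !arc_induced => /and3P[_ _ ab] _ _.
  by have [aD bD _] := arcP ab; rewrite !inB.
rewrite arcB ?mutually_connected_refl // => /(_ isT)/negP[].
apply: connect_sub (connect_within (Q := mutually_connected ee x) yx _) => [a b /=|z yz zx].
  by case/and3P=> xa xb ab; apply/connect1/arcB.
by apply/andP; split=> //; apply: connect_trans (connect1 xy) yz.
Qed.

Lemma dichromatic_gt0 D A :
  0 < dichromatic_number (induced D A) -> exists x, x \in A.
Proof.
have [A0|[x xA] _] := set_0Vmem A; last by exists x.
rewrite lt0n => /negP[]; rewrite -leqn0.
apply: (dichromatic_le_colours (f := fun=> tt) (s := [::])) => [z | k].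
  by rewrite vertices_induced A0 setI0 inE.
apply/acyclic_connect => x y; rewrite arc_induced => /and3P[].
by rewrite in_set vertices_induced A0 setI0 in_set0.
Qed.

(** If no layer has dichromatic number at least c, then 4(c - 1) + 1 < 4c colours
    suffice for S. *)
Lemma exists_hub D S c : 0 < c -> 4 * c <= dichromatic_number (induced D S) ->
  exists A v, [/\ A \subset S, v \in S :\: A, c <= dichromatic_number (induced D A)
    & {in A, forall x, mutually_connected (arc (induced D (x |: S :\: A))) v x}].
Proof.
move=> c0 chiS; set e := arc (induced D S).
case: (boolP [exists x, c <= dichromatic_number (induced D (bfs_layer e x))]).
  case/existsP=> x chiA; exists (bfs_layer e x), (scc_rep e x).
  set A := bfs_layer e x in chiA *.
  have conn y : y \in A ->
      mutually_connected (arc (induced D (y |: S :\: A))) (scc_rep e x) y.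
    have sub a b : [&& a \in y |: ~: A, b \in y |: ~: A & e a b] ->
        connect (arc (induced D (y |: S :\: A))) a b.
      rewrite /e arc_induced => /and5P[aA bA aS bS ab]; apply: connect1.
      move: aA bA; rewrite arc_induced !inE ab aS bS !andbT => -> ->.
      by [].
    case/bfs_layer_connected/andP=> H1 H2.
    by apply/andP; split; [apply: connect_sub H1 | apply: connect_sub H2].
  split=> //; first exact: bfs_layer_sub.
  have rep_notin : scc_rep e x \notin A.
    by rewrite inE -(eq_scc_rep (scc_rep_connected e x)) eqxx andbF.
  have [A0|[y yA]] := set_0Vmem A.
    by have [y] := dichromatic_gt0 (leq_trans c0 chiA); rewrite A0 inE.
  rewrite inE rep_notin.
  move: yA; rewrite inE => /and4P[/eqP Er nry _ _].
  have /andP[yr _] := scc_rep_connected e y; rewrite -Er.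
  by apply: connect_induced_mem yr _; rewrite eq_sym.
move=> /existsPn chiL.
suff /(leq_trans chiS) : dichromatic_number (induced D S) <= (4 * c.-1).+1.
  by case: c c0 {chiS chiL} => // c _; rewrite mulnS /= addSn ltnS -[leqRHS]add0n leq_add2r.
apply: dichromatic_le_layers => x; rewrite -ltnS prednK // ltnNge.
exact: chiL.
Qed.

(** Each hub is found inside the previous layer, so the rings R i, which are the
    differences of consecutive layers, are disjoint, and the connections of the
    final set L to an early hub are inherited from the larger layer. *)
Lemma nested_hubs D k c S : 0 < c -> c * 4 ^ k <= dichromatic_number (induced D S) ->
  exists (L : {set T}) (R : nat -> {set T}) (v : nat -> T),
  [/\ L \subset S, c <= dichromatic_number (induced D L),
      forall i, i < k -> v i \in R i /\ R i \subset S :\: L,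
      forall i j, i < k -> j < k -> i != j -> [disjoint R i & R j]
    & forall i x, i < k -> x \in L ->
        mutually_connected (arc (induced D (x |: R i))) (v i) x].
Proof.
move=> c0; elim: k S => [|k IHk] S chiS.
  have [|x _] := @dichromatic_gt0 D S; first by rewrite (leq_trans _ chiS) ?muln1.
  by exists S, (fun=> set0), (fun=> x); rewrite muln1 in chiS; split.
rewrite expnS mulnCA in chiS.
have [|A [w [sAS wSA chiA hubA]]] := exists_hub _ chiS.
  by rewrite muln_gt0 c0 expn_gt0.
have [L [R [v [sLA chiL vR disR hubR]]]] := IHk A chiA.
exists L, (fun i => if i is i'.+1 then R i' else S :\: A),
  (fun i => if i is i'.+1 then v i' else w).
have dis0 i : i < k -> [disjoint S :\: A & R i].
  move=> /vR[_ /subsetP sR]; rewrite -setI_eq0; apply/eqP/setP => x; rewrite !inE.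
  by apply/negP => /andP[/andP[/negP nA _] /sR]; rewrite inE => /andP[_ /nA].
split=> //; first exact: subset_trans sAS.
- move=> [_|i /vR[vi sR]]; first by split=> //; apply: setDS.
  by split=> //; apply: subset_trans sR (setSD _ sAS).
- move=> [|i] [|j] //= ik jk; first by move=> _; apply: dis0.
    by move=> _; rewrite disjoint_sym dis0.
  by rewrite eqSS; apply: disR.
by move=> [|i] x ik xL; [apply/hubA/(subsetP sLA) | apply: hubR].
Qed.

(** * Assembling the minor *)

Lemma strongly_connected_scc D A v :
  strongly_connected
    (induced D [set z | mutually_connected (arc (induced D A)) v z]).
Proof.
set e := arc (induced D A); set B := [set z | _].
have arcB a b : [&& a \in B, b \in B & e a b] -> connect (arc (induced D B)) a b.
  move=> /and3P[aB bB]; rewrite /e arc_induced => /and3P[_ _ ab].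
  by apply: connect1; rewrite arc_induced aB bB.
apply/forall_inP => x; rewrite vertices_induced !in_setI => /andP[_ xB].
apply/forall_inP => y; rewrite in_setI => /andP[_ yB].
have := xB; have := yB; rewrite !inE => /andP[vy yv] /andP[vx xv].
apply: connect_sub (connect_within (Q := mem B) (connect_trans xv vy) _).
  exact: arcB.
move=> z xz zy; rewrite /= inE; apply/andP; split; first exact: connect_trans xz.
exact: connect_trans yv.
Qed.

Lemma sm_ge_branch_sets D r (B : 'I_r -> {set T}) :
    (forall i, B i \subset vertices D) -> (forall i, B i != set0) ->
    (forall i j, i != j -> [disjoint B i & B j]) ->
    (forall i, strongly_connected (induced D (B i))) ->
    (forall i j, i != j -> exists a b, [/\ a \in B i, b \in B j & arc D a b]) ->
  r <= sm D.
Proof.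
move=> BV B0 Bdis Bsc Barc.
have Binj : injective B.
  move=> i j Eij; apply/eqP; apply: contraNT (B0 i) => /Bdis.
  by rewrite -Eij -setI_eq0 setIid.
pose P := [set B i | i : 'I_r].
have BU i : B i \subset cover P by apply: (bigcup_sup (B i)); rewrite // imset_f.
rewrite /sm; case: ex_maxnP => s _; apply.
apply/existsP; exists (induced D (cover P)); apply/andP; split.
  rewrite /subdigraph vertices_induced subsetIl /=.
  by apply/subsetP => -[a b]; rewrite inE => /andP[].
apply/existsP; exists P; apply/and4P; split.
- apply/and3P; split.
  + rewrite vertices_induced eq_sym; apply/eqP/setIidPr.
    by apply/bigcupsP => _ /imsetP[i _ ->].
  + apply/trivIsetP => _ _ /imsetP[i _ ->] /imsetP[j _ ->] nij.
    by apply: Bdis; apply: contraNneq nij => ->.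
  + by apply/imsetP => -[i _ Bi0]; have := B0 i; rewrite -Bi0 eqxx.
- by rewrite card_imset // card_ord.
- apply/forall_inP => _ /imsetP[i _ ->].
  by rewrite induced_induced (setIidPr (BU i)).
apply/forall_inP => _ /imsetP[i _ ->]; apply/forall_inP => _ /imsetP[j _ ->].
apply/implyP => nij; have [|a [b [aB bB ab]]] := Barc i j.
  by apply: contraNneq nij => ->.
apply/exists_inP; exists a => //; apply/exists_inP; exists b => //.
by rewrite arc_induced ab (subsetP (BU i)) ?(subsetP (BU j)).
Qed.

End Hubs.

Theorem theorem1p5 (T : finType) (D : digraph T) (r : nat) (r_ge1 : 1 <= r)
    (chi_ge : r * 4 ^ r <= dichromatic_number D) :
  r <= sm D.
Proof.
rewrite -{1}[D]induced_vertices in chi_ge.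
have [L [R [v [sLD chiL vR disR hubR]]]] := nested_hubs r_ge1 chi_ge.
have [f complete] := optimal_colouring_complete (induced D L).
pose X i := [set x in L | f x == i].
pose B (i : 'I_r) :=
  [set z | mutually_connected (arc (induced D (X i :|: R i))) (v i) z].
have vRi (i : 'I_r) := vR i (ltn_ord i).
have BXR i : B i \subset X i :|: R i.
  apply/subsetP => z; rewrite inE => /andP[vz _].
  have [->|] := eqVneq z (v i); first by rewrite inE (vRi i).1 orbT.
  exact: connect_induced_mem vz.
have vB (i : 'I_r) : v i \in B i by rewrite inE mutually_connected_refl.
have XB (i : 'I_r) : X i \subset B i.
  apply/subsetP => x xX; rewrite inE.
  have sub : x |: R i \subset X i :|: R i by rewrite setSU // sub1set.
  have xL : x \in L by move: xX; rewrite inE => /andP[].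
  have /andP[vx xv] := hubR i x (ltn_ord i) xL.
  by apply/andP; split; apply: connect_induced_sub sub _.
have RL (i : 'I_r) x : x \in R i -> x \in vertices D /\ x \notin L.
  by have [_ /subsetP sR] := vRi i; move=> /sR; rewrite inE => /andP[].
apply: (@sm_ge_branch_sets _ _ _ B).
- move=> i; apply/subsetP => z /(subsetP (BXR i)); rewrite !inE.
  by case/orP=> [/andP[/(subsetP sLD)] | /RL[]].
- by move=> i; apply/set0Pn; exists (v i).
- move=> i j nij; rewrite -setI_eq0; apply/eqP/setP => z; rewrite in_set0 in_setI.
  apply/negP => /andP[/(subsetP (BXR i)) + /(subsetP (BXR j))]; rewrite !inE.
  case/orP=> [/andP[zL /eqP fi] | zRi]; case/orP=> [/andP[zL' /eqP fj] | zRj].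
  + by case/eqP: nij; apply: val_inj; rewrite /= -fi -fj.
  + by have [_ /negP] := RL j z zRj.
  + by have [_ /negP] := RL i z zRi.
  have := disR i j (ltn_ord i) (ltn_ord j) nij.
  by rewrite -setI_eq0 => /eqP/setP/(_ z); rewrite !inE zRi zRj.
- by move=> i; apply: strongly_connected_scc.
move=> i j nij; have lt (l : 'I_r) := leq_trans (ltn_ord l) chiL.
have [x [y [fx fy]]] := complete i j (lt i) (lt j) nij.
rewrite arc_induced => /and3P[xL yL xy]; exists x, y; split=> //.
  by apply: (subsetP (XB i)); rewrite inE xL fx eqxx.
by apply: (subsetP (XB j)); rewrite inE yL fy eqxx.
Qed.
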